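(* Let $n\geq 3$ be an integer and let $p(z)=z^n+a_{n-1}z^{n-1}+a_{n-2}z^{n-2}+\ldots+a_1z+a_0$ be a monic polynomial with complex coefficients and $a_0\neq 0$. If $z\in\mathbb{C}$ is any zero of $p$, then \[\begin{aligned} |z|^2 \leq{}& \cos^2 \frac{\pi}{n}+ \frac{1}{4} \left ( |a_{n-1}|+ \sqrt{(1+|a_{n-2}|)^2+ \sum_{j=0,\,j\neq n-2}^{n-1}|a_j|^2}\right)^2\\ &+ \sqrt{\frac{ \left (1+ \sum_{j=0}^{n-1}|a_j|^2 \right)+ \sqrt{\left(1-\sum_{j=0}^{n-1}|a_j|^2\right)^2+4|a_{n-1}|^2 } }{2} }. \end{aligned}\] *)

(* Defs.v *)
From mathcomp Require Import all_boot all_order all_algebra.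
From mathcomp Require Import all_classical all_reals all_analysis.
From mathcomp Require Import complex.

Set Implicit Arguments.
Unset Strict Implicit.
Unset Printing Implicit Defensive.

(* The modulus with values in R itself; the library norm `|z| on R[i] takes
   values in R[i] and equals (cmod z)%:C. *)
Notation cmod := ComplexField.Normc.normc.

(* Main.v *)
(* With x = (z^(n-1), ..., z, 1), the companion matrix C satisfies C x = z x.
   Write C = A + B, where A consists of the first two rows of C and B of the
   others, so that |z| |x|^2 <= |<Ax, x>| + |<Bx, x>|. The three terms of the
   bound come from squaring this: B is a shift along a path of n - 1 vertices,
   of numerical radius cos (pi / n); A has rank two and an explicit numerical
   radius bound; and, since A and B have orthogonal ranges, the cross term is at
   most |A| |B| |x|^4 (operator norms), where |B| <= 1. Since only moduli
   enter these estimates, x may be replaced by (|z|^(n-1), ..., |z|, 1). *)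
Require Import Defs.
From mathcomp Require Import all_boot all_order all_algebra.
From mathcomp Require Import all_classical all_reals all_analysis.
From mathcomp Require Import complex.
From mathcomp Require Import ring lra.
Import Order.TTheory GRing.Theory Num.Theory.
Local Open Scope ring_scope.

(** The matrix [[a, -b], [-b, c]] is positive semidefinite, its diagonal entries and its determinant
    being nonnegative. *)
Lemma ler_form2 (R : realFieldType) (a b c x y : R) :
  0 <= a -> 0 <= c -> b ^+ 2 <= a * c ->
  2 * (b * (x * y)) <= a * x ^+ 2 + c * y ^+ 2.
Proof.
move=> a0 c0 bac.
have a_x : 0 <= a * x ^+ 2 by rewrite mulr_ge0 ?sqr_ge0.
have c_y : 0 <= c * y ^+ 2 by rewrite mulr_ge0 ?sqr_ge0.
apply: le_trans (ler_norm _) _.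
rewrite -(@ler_pXn2r _ 2) ?nnegrE ?addr_ge0 // real_normK ?num_real //.
have := ler_wpM2r (sqr_ge0 (x * y)) bac.
have := sqr_ge0 (a * x ^+ 2 - c * y ^+ 2).
nra.
Qed.

(** Appends one coordinate to a Cauchy-Schwarz bound. Beyond the induction below, it serves to add
    single entries to such bounds later. *)
Lemma cauchy_schwarz_step (R : realFieldType) (s u v x y : R) :
  0 <= u -> 0 <= v -> s ^+ 2 <= u * v ->
  (s + x * y) ^+ 2 <= (u + x ^+ 2) * (v + y ^+ 2).
Proof.
move=> u0 v0 suv; have := @ler_form2 R u s v y x u0 v0 suv; nra.
Qed.

Lemma cauchy_schwarz_sum (R : realFieldType) (k : nat) (x y : nat -> R) :
  (\sum_(0 <= j < k) x j * y j) ^+ 2 <=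
  (\sum_(0 <= j < k) x j ^+ 2) * (\sum_(0 <= j < k) y j ^+ 2).
Proof.
elim: k => [|k IH]; first by rewrite !big_geq // expr0n mul0r.
rewrite !big_nat_recr //=; apply: cauchy_schwarz_step IH;
  by apply: sumr_ge0 => j _; exact: sqr_ge0.
Qed.

(* Each product is split by AM-GM with the weights [s j.+2 / s j.+1] coming
   from a positive eigenvector [s] of the path. *)
Lemma path_form_le (R : realFieldType) (c : R) (s y : nat -> R) (k : nat) :
  s 0%N = 0 -> (forall j, (j <= k)%N -> 0 < s j.+1) ->
  (forall j, s j + s j.+2 = 2 * c * s j.+1) ->
  2 * \sum_(0 <= j < k) y j * y j.+1 <=
  2 * c * \sum_(0 <= j < k) y j ^+ 2 + s k / s k.+1 * y k ^+ 2.
Proof.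
move=> s0 + rec; elim: k => [|k IH] spos.
  by rewrite !big_geq // s0 !mul0r !mulr0 addr0.
rewrite !big_nat_recr //=.
have {}IH := IH (fun j jk => spos j (leqW jk)).
have s1 := spos k (leqnSn k); have s2 := spos k.+1 (leqnn _).
have rk : s k / s k.+1 + s k.+2 / s k.+1 = 2 * c.
  by rewrite -mulrDl rec mulfK ?gt_eqF.
have : 2 * (1 * (y k * y k.+1)) <=
    s k.+2 / s k.+1 * y k ^+ 2 + s k.+1 / s k.+2 * y k.+1 ^+ 2.
  apply: ler_form2; try by rewrite divr_ge0 ?ltW.
  by rewrite mulrA divfK ?gt_eqF // divff ?gt_eqF // expr1n.
rewrite -rk in IH *; nra.
Qed.

(** The eigenvector is sin (j th) with th = pi / (m + 3). It vanishes at j = m + 3, just past the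
    last vertex, so the weight left there is exactly 2 cos th, the same as at every other vertex. *)
Lemma path_form_le_cos (R : realType) (m : nat) (y : nat -> R) :
  \sum_(0 <= j < m.+1) y j * y j.+1 <=
  cos (pi / m.+3%:R) * (\sum_(0 <= j < m.+2) y j ^+ 2).
Proof.
set th := pi / m.+3%:R; pose s j : R := sin (j%:R * th).
have th0 : 0 < th by rewrite divr_gt0 ?pi_gt0 ?ltr0n.
have rec j : s j + s j.+2 = 2 * cos th * s j.+1.
  have -> : s j = sin (j.+1%:R * th - th).
    by rewrite /s -natr1; congr sin; ring.
  have -> : s j.+2 = sin (j.+1%:R * th + th).
    by rewrite /s -[j.+2%:R]natr1; congr sin; ring.
  rewrite sinB sinD /s; ring.
have s_end : s m.+3 = 0.
  by rewrite /s /th mulrC divfK ?pnatr_eq0 // sinpi.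
have spos j : (j <= m.+1)%N -> 0 < s j.+1.
  move=> jm; apply: sin_gt0_pi; rewrite mulr_gt0 ?ltr0n //=.
  by rewrite /th mulrA ltr_pdivrMr ?ltr0n // mulrC ltr_pM2l ?pi_gt0 // ltr_nat.
have s0 : s 0%N = 0 by rewrite /s mul0r sin0.
have := @path_form_le R (cos th) s y m.+1 s0 spos rec.
have -> : s m.+1 / s m.+2 = 2 * cos th.
  by have := rec m.+1; rewrite s_end addr0 => ->; rewrite mulfK ?gt_eqF ?spos.
rewrite [X in _ -> _ <= _ * X]big_nat_recr //=; lra.
Qed.

(* [lam] bounds the squared norm of A: it is the largest eigenvalue of [[S, al], [al, 1]]. *)
Lemma two_row_norm_le (R : rcfType) (al S Z E t T : R) :
  0 <= Z -> 0 <= E -> T ^+ 2 <= Z * E -> S = Z + al ^+ 2 ->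
  let lam := ((1 + S) + Num.sqrt ((1 - S) ^+ 2 + 4 * al ^+ 2)) / 2 in
  (T + al * t) ^+ 2 + t ^+ 2 <= lam * (E + t ^+ 2).
Proof.
move=> Z0 E0 TZE SE; cbv zeta; set d := Num.sqrt _; set lam := _ / 2.
have dsq : d ^+ 2 = (1 - S) ^+ 2 + 4 * al ^+ 2.
  by rewrite sqr_sqrtr // addr_ge0 ?sqr_ge0 // mulr_ge0 ?sqr_ge0.
have d0 : 0 <= d by exact: sqrtr_ge0.
have al0 := sqr_ge0 al.
have dS : `|1 - S| <= d.
  rewrite -(@ler_pXn2r _ 2) ?nnegrE // real_normK ?num_real // dsq; lra.
have lamS : S <= lam by move: dS; rewrite ler_norml /lam => /andP[]; lra.
have lam1 : 1 <= lam by move: dS; rewrite ler_norml /lam => /andP[]; lra.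
have lamE : lam ^+ 2 = (1 + S) * lam - Z.
  by rewrite /lam expr_div_n sqrrD dsq SE; field.
set U := T + al * t.
have W0 : 0 <= U ^+ 2 + t ^+ 2 by rewrite addr_ge0 ?sqr_ge0.
(* By the characteristic equation [lamE], the determinant (lam - S) (lam - 1) - al^2 is zero. *)
have : 2 * (al * (U * t)) <= (lam - S) * U ^+ 2 + (lam - 1) * t ^+ 2.
  apply: ler_form2; rewrite ?subr_ge0 //.
  have -> : (lam - S) * (lam - 1) = lam ^+ 2 - (1 + S) * lam + S by ring.
  by rewrite lamE SE; lra.
(* Duality: with A' the adjoint of A, |Ax|^2 is the pairing of A'Ax with x, so |Ax|^4 <= |A'Ax|^2
   |x|^2. The form bound above gives |A'Ax|^2 <= lam |Ax|^2, and one factor |Ax|^2 cancels unless it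
   is zero. *)
have CS : (U * T + (U * al + t) * t) ^+ 2 <=
    (U ^+ 2 * Z + (U * al + t) ^+ 2) * (E + t ^+ 2).
  apply: cauchy_schwarz_step => //; first by rewrite mulr_ge0 ?sqr_ge0.
  by rewrite exprMn -[X in _ <= X]mulrA ler_wpM2l ?sqr_ge0.
have WE : U * T + (U * al + t) * t = U ^+ 2 + t ^+ 2 by rewrite /U; ring.
move=> form; rewrite {}WE in CS.
have [->|Wn0] := eqVneq (U ^+ 2 + t ^+ 2) 0.
  by rewrite mulr_ge0 ?addr_ge0 ?sqr_ge0 //; lra.
have Wpos : 0 < U ^+ 2 + t ^+ 2 by rewrite lt_def Wn0.
rewrite -(ler_pM2r Wpos) -expr2 (le_trans CS) //.
rewrite [X in _ <= X]mulrAC; apply: ler_wpM2r; first by rewrite addr_ge0 ?sqr_ge0.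
by rewrite SE in form; lra.
Qed.

(** With q^2 = g - al^2, the left side is at most the form of [[0, q/2], [q/2, al]] at (sqrt F,
    |t|), whose larger eigenvalue is (al + sqrt g) / 2. *)
Lemma two_row_numrad_le (R : rcfType) (al g V F t : R) :
  0 <= al -> 0 <= F -> al ^+ 2 <= g -> V ^+ 2 <= (g - al ^+ 2) * F ->
  t * (V + al * t) <= (al + Num.sqrt g) / 2 * (F + t ^+ 2).
Proof.
move=> al0 F0 alg VF.
have g0 : 0 <= g by apply: le_trans alg; exact: sqr_ge0.
have gsq := sqr_sqrtr g0; set r := Num.sqrt g in gsq *.
have r0 : 0 <= r by exact: sqrtr_ge0.
have alr : al <= r by rewrite -(@ler_pXn2r _ 2) ?nnegrE // gsq.
have Fsq := sqr_sqrtr F0; set f := Num.sqrt F in Fsq.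
have form : 2 * (V * (t * 1)) <= (r - al) * t ^+ 2 + ((r + al) * F) * 1 ^+ 2.
  apply: ler_form2; rewrite ?subr_ge0 ?mulr_ge0 ?addr_ge0 //.
  by rewrite mulrA -subr_sqr gsq.
nra.
Qed.

(* [P] and [Q] are <|A|y, y> and <By, y> in the header's decomposition, with
   coordinates listed by increasing powers of z. Ay and By have disjoint
   supports, whence [2 P Q <= |Ay| |By| |y|^2 <= |A| |y|^4]. *)
Lemma split_form_le (R : realType) (m : nat) (b y : nat -> R) :
  (forall j, 0 <= b j) -> (forall j, 0 <= y j) ->
  let N := \sum_(0 <= j < m.+3) y j ^+ 2 in
  let S := \sum_(0 <= j < m.+3) b j ^+ 2 in
  let P := y m.+2 * (\sum_(0 <= j < m.+3) b j * y j + y m.+1) in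
  let Q := \sum_(0 <= j < m.+1) y j * y j.+1 in
  (P + Q) ^+ 2 <=
  (cos (pi / m.+3%:R) ^+ 2
   + 1 / 4 * (b m.+2 + Num.sqrt ((1 + b m.+1) ^+ 2
        + \sum_(0 <= j < m.+3 | j != m.+1) b j ^+ 2)) ^+ 2
   + Num.sqrt (((1 + S) + Num.sqrt ((1 - S) ^+ 2 + 4 * b m.+2 ^+ 2)) / 2))
  * N ^+ 2.
Proof.
move=> b0 y0; cbv zeta.
set N := \sum_(0 <= j < m.+3) y j ^+ 2; set S := \sum_(0 <= j < m.+3) b j ^+ 2.
set P := _ * (_ + _); set Q := \sum_(0 <= j < m.+1) _.
set c := cos _; set G := (_ + \sum_(0 <= j < m.+3 | _) _); set lam := _ / 2.
pose Z := \sum_(0 <= j < m.+1) b j ^+ 2.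
pose E := \sum_(0 <= j < m.+1) y j ^+ 2.
pose T := \sum_(0 <= j < m.+1) b j * y j.
have Z0 : 0 <= Z by apply: sumr_ge0 => j _; exact: sqr_ge0.
have E0 : 0 <= E by apply: sumr_ge0 => j _; exact: sqr_ge0.
have T0 : 0 <= T by apply: sumr_ge0 => j _; exact: mulr_ge0.
have Q0 : 0 <= Q by apply: sumr_ge0 => j _; exact: mulr_ge0.
have TZE : T ^+ 2 <= Z * E by exact: cauchy_schwarz_sum.
set al := b m.+2; set b1 := b m.+1.
set t := y m.+2; set p := y m.+1.
have al0 : 0 <= al by exact: b0.
have b10 : 0 <= b1 by exact: b0.
have t0 : 0 <= t by exact: y0.
have p0 : 0 <= p by exact: y0.
have NE : N = E + p ^+ 2 + t ^+ 2 by rewrite /N 2?big_nat_recr.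
have SE : S = Z + b1 ^+ 2 + al ^+ 2 by rewrite /S 2?big_nat_recr.
have GE : G = (1 + b1) ^+ 2 + (Z + al ^+ 2).
  rewrite /G big_mkcond 2?big_nat_recr //= eqxx (gtn_eqF (leqnn _)) /= addr0.
  congr (_ + (_ + _)); apply: eq_big_nat => j /andP[_ jm].
  by rewrite ltn_eqF.
have PE : P = t * (T + b1 * p + al * t + p) by rewrite /P 2?big_nat_recr.
have P0 : 0 <= P by rewrite PE mulr_ge0 ?addr_ge0 ?mulr_ge0.
have c0 : 0 <= c.
  apply: cos_ge0_pihalf; rewrite (@le_trans _ _ 0) /=.
  - by rewrite ler_pM2l ?pi_gt0 // lef_pV2 ?posrE ?ltr0n // ler_nat.
  - by rewrite oppr_le0 divr_ge0 ?pi_ge0.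
  - by rewrite divr_ge0 ?pi_ge0 ?ler0n.
have p20 := sqr_ge0 p; have t20 := sqr_ge0 t.
have Qc : Q <= c * N.
  apply: le_trans (@path_form_le_cos R m y) _.
  rewrite ler_wpM2l // NE big_nat_recr //=; rewrite -/E -/p; lra.
have Pw : P <= (al + Num.sqrt G) / 2 * N.
  (* The entry 1 of the second row contributes the product t p, as [b1] does; hence the coefficient
     1 + b1. *)
  have -> : P = t * ((T + (1 + b1) * p) + al * t) by rewrite PE; ring.
  rewrite NE; apply: two_row_numrad_le => //.
  - by rewrite addr_ge0.
  - by rewrite GE addrA lerDr addr_ge0 ?sqr_ge0.
  - have -> : G - al ^+ 2 = Z + (1 + b1) ^+ 2 by rewrite GE; ring.
    exact: cauchy_schwarz_step.
have Pn : P ^+ 2 <= lam * N * (t ^+ 2 + p ^+ 2).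
  set U := T + b1 * p + al * t.
  have : U ^+ 2 + t ^+ 2 <= lam * (E + p ^+ 2 + t ^+ 2).
    apply: (@two_row_norm_le _ al S (Z + b1 ^+ 2)) => //.
    - by rewrite addr_ge0 ?sqr_ge0.
    - by rewrite addr_ge0.
    - exact: cauchy_schwarz_step.
  rewrite -NE => /(ler_wpM2r (addr_ge0 t20 p20)); apply: le_trans.
  (* P is the inner product of (U, t) and (t, p). *)
  by rewrite PE -/U; have := sqr_ge0 (U * p - t ^+ 2); nra.
have Qn : Q ^+ 2 <= E * N.
  apply: le_trans (@cauchy_schwarz_sum R m.+1 y (y \o succn)) _.
  have -> : N = y 0%N ^+ 2 + (\sum_(0 <= j < m.+1) y j.+1 ^+ 2 + t ^+ 2).
    by rewrite /N big_nat_recl // big_nat_recr.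
  by rewrite ler_wpM2l //= addrCA lerDl addr_ge0 ?sqr_ge0.
have N0 : 0 <= N by rewrite NE !addr_ge0.
have lam0 : 0 <= lam.
  by rewrite divr_ge0 // !addr_ge0 ?sqrtr_ge0 // SE !addr_ge0 ?sqr_ge0.
clearbody N P Q.
(* [Pn] and [Qn] involve the complementary parts t^2 + p^2 and E of N, whose product is at most N^2
   / 4; this absorbs the factor 2. *)
have PQ : 2 * (P * Q) <= Num.sqrt lam * N ^+ 2.
  rewrite -(@ler_pXn2r _ 2) ?nnegrE ?mulr_ge0 ?sqrtr_ge0 ?sqr_ge0 //.
  rewrite [X in _ <= X]exprMn sqr_sqrtr //.
  have := ler_pM (sqr_ge0 P) (sqr_ge0 Q) Pn Qn.
  have : 4 * ((t ^+ 2 + p ^+ 2) * E) <= N ^+ 2.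
    by rewrite NE; have := sqr_ge0 (t ^+ 2 + p ^+ 2 - E); nra.
  have lN : 0 <= lam * N ^+ 2 by rewrite mulr_ge0 ?sqr_ge0.
  move=> /(ler_wpM2l lN); nra.
have P2 : P ^+ 2 <= ((al + Num.sqrt G) / 2 * N) ^+ 2.
  by rewrite ler_pXn2r ?nnegrE // (le_trans P0).
have Q2 : Q ^+ 2 <= (c * N) ^+ 2 by rewrite ler_pXn2r ?nnegrE // (le_trans Q0).
lra.
Qed.

Lemma cmod_root_le (R : rcfType) (n : nat) (p : {poly R[i]}) (z : R[i]) :
  p \is monic -> size p = n.+1 -> root p z ->
  cmod z ^+ n <= \sum_(0 <= j < n) cmod p`_j * cmod z ^+ j.
Proof.
move=> /monicP; rewrite lead_coefE => + sz; rewrite sz /= => pn1.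
rewrite /root horner_coef sz big_ord_recr /= pn1 mul1r addrC addr_eq0 => /eqP zE.
rewrite -lecR rmorph_sum rmorphXn /=.
have -> : (cmod z)%:C%C = `|z| by [].
rewrite -normrX zE normrN big_mkord; apply: le_trans (ler_norm_sum _ _ _) _.
by apply: ler_sum => j _; rewrite normrM normrX rmorphM rmorphXn.
Qed.

Theorem theorem2p6 (R : realType) (n : nat) (p : {poly R[i]}) (z : R[i])
    (n_ge3 : (3 <= n)%N) (p_monic : p \is monic) (size_p : size p = n.+1)
    (p0_neq0 : p`_0 != 0) (pz0 : root p z) :
  cmod z ^+ 2 <=
    cos (pi / n%:R) ^+ 2
    + 1 / 4 * (cmod p`_(n - 1)
               + Num.sqrt ((1 + cmod p`_(n - 2)) ^+ 2
                           + \sum_(0 <= j < n | j != (n - 2)%N) cmod p`_j ^+ 2))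
              ^+ 2
    + Num.sqrt (((1 + \sum_(0 <= j < n) cmod p`_j ^+ 2)
                 + Num.sqrt ((1 - \sum_(0 <= j < n) cmod p`_j ^+ 2) ^+ 2
                             + 4 * cmod p`_(n - 1) ^+ 2)) / 2).
Proof.
have zle := @cmod_root_le R n p z p_monic size_p pz0.
case: n n_ge3 size_p zle => [|[|[|m]]] // _ _ zle.
rewrite !subSS !subn0.
have cmod0 (x : R[i]) : 0 <= cmod x by rewrite -lecR; exact: (normr_ge0 x).
set r : R := cmod z in zle *; have r0 : 0 <= r by exact: cmod0.
have := @split_form_le R m (fun j => cmod p`_j) (fun j => r ^+ j)
  (fun j => cmod0 _) (fun j => exprn_ge0 j r0).
cbv zeta; set N := \sum_(0 <= j < m.+3) (r ^+ j) ^+ 2.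
have Npos : 0 < N.
  rewrite /N big_nat_recl //= expr0 expr1n ltr_pwDl //.
  by apply: sumr_ge0 => j _; exact: sqr_ge0.
(* In r N, the sum of all r^(2j+1), only the factor r^n of the top term is estimated, by the root
   bound [zle]. *)
set PQ := _ + _; have rN : r * N <= PQ.
  have -> : r * N = r ^+ m.+2 * (r ^+ m.+3 + r ^+ m.+1)
      + \sum_(0 <= j < m.+1) r ^+ j * r ^+ j.+1.
    have rsq j : r * (r ^+ j) ^+ 2 = r ^+ j * r ^+ j.+1
      by rewrite expr2 mulrCA -exprS.
    rewrite /N 2?big_nat_recr //= !mulrDr mulr_sumr !rsq.
    by rewrite (eq_bigr _ (fun j _ => rsq j)); ring.
  by rewrite lerD2r ler_wpM2l ?exprn_ge0 // lerD2r.
move=> le; rewrite -(ler_pM2r (exprn_gt0 2 Npos)) -exprMn.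
apply: le_trans le; rewrite ler_pXn2r ?nnegrE ?mulr_ge0 ?(ltW Npos) //.
by apply: le_trans rN; rewrite mulr_ge0 ?(ltW Npos).
Qed.
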